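(* Let $k$ be a field of characteristic zero. If $\sqrt{-3}\notin k$, then $E_K(k(u))_{\rm tors}=0$. If $\sqrt{-3}\in k$, then $E_K(k(u))_{\rm tors}\cong\mathbb Z/3\mathbb Z$, generated by $$(x,y)=(0,\,12\sqrt{-3}\,K(u)).$$ In particular, $E_K(\mathbb Q(u))_{\rm tors}=0$, $E_K(\mathbb Q(\sqrt{-3})(u))_{\rm tors}\cong\mathbb Z/3\mathbb Z$, and $E_K(\overline{\mathbb Q}(u))_{\rm tors}\cong\mathbb Z/3\mathbb Z$.
   Context: $E_K$ is the elliptic curve $y^2=x^3-432K(u)^2$ over $\mathbb Q(u)$ (base-changed to $k(u)$), where $K(u)=p(u)^3+q(u)^3$ with $p(u)=1-13u+26u^2$ and $q(u)=6+182u^2$. The subscript ''tors'' denotes the torsion subgroup. *)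

(* Defs.v *)
From HB Require Import structures.
From mathcomp Require Import all_boot all_order all_algebra all_field.
From mathcomp Require Import ring.

Set Implicit Arguments.
Unset Strict Implicit.
Unset Printing Implicit Defensive.

Import GRing.Theory Num.Theory.
Local Open Scope ring_scope.

(* [EllipticCurve a b _] is the curve y^2 = x^3 + a x + b. The factor -16 of
   the discriminant also rules out characteristic 2. *)
Record ellipticCurve (F : fieldType) := EllipticCurve {
  coefA : F;
  coefB : F;
  discriminant_neq0 : - 16 * (4 * coefA ^+ 3 + 27 * coefB ^+ 2) != 0
}.

Section Points.

Variables (F : fieldType) (E : ellipticCurve F).

Local Notation a := (coefA E).
Local Notation b := (coefB E).

(* [None] is the point at infinity. *)
Definition on_curve (P : option (F * F)) : bool :=
  if P is Some (x, y) then y ^+ 2 == x ^+ 3 + a * x + b else true.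

Definition point := {P : option (F * F) | on_curve P}.

Definition raw_opp (P : option (F * F)) : option (F * F) :=
  if P is Some (x, y) then Some (x, - y) else None.

(* The chord-and-tangent law. *)
Definition raw_add (P Q : option (F * F)) : option (F * F) :=
  match P, Q with
  | None, _ => Q
  | _, None => P
  | Some (x1, y1), Some (x2, y2) =>
      if (x1 == x2) && (y1 == - y2) then None else
      let m := if x1 == x2 then (3 * x1 ^+ 2 + a) / (2 * y1)
               else (y2 - y1) / (x2 - x1) in
      let x3 := m ^+ 2 - x1 - x2 in
      Some (x3, m * (x1 - x3) - y1)
  end.

Lemma two_neq0 : (2 : F) != 0.
Proof.
apply/eqP => h; have := discriminant_neq0 E.
have -> : (16 : F) = 2 * 8 by ring.
by rewrite h mul0r oppr0 mul0r eqxx.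
Qed.

Lemma on_curve_opp P : on_curve P -> on_curve (raw_opp P).
Proof. by case: P => [[x y]|] //=; rewrite sqrrN. Qed.

Lemma on_curve_add P Q : on_curve P -> on_curve Q -> on_curve (raw_add P Q).
Proof.
case: P Q => [[x1 y1]|] [[x2 y2]|] //= /eqP h1 /eqP h2.
case: eqVneq => [e|nx] /=; last first.
  have d : x2 - x1 != 0 by rewrite subr_eq0 eq_sym.
  set m := _ / _.
  have my : m * (x2 - x1) = y2 - y1 by rewrite /m mulfVK.
  have dm : (m * (y1 + y2) - (x1 ^+ 2 + x1 * x2 + x2 ^+ 2 + a)) * (x2 - x1) = 0.
    transitivity (m * (x2 - x1) * (y1 + y2)
       - (x1 ^+ 2 + x1 * x2 + x2 ^+ 2 + a) * (x2 - x1)); first by ring.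
    rewrite my; transitivity (y2 ^+ 2 - y1 ^+ 2
       - (x1 ^+ 2 + x1 * x2 + x2 ^+ 2 + a) * (x2 - x1)); first by ring.
    by rewrite h1 h2; ring.
  move/eqP: dm; rewrite mulf_eq0 (negPf d) orbF => /eqP dm.
  have y2E : y2 = y1 + m * (x2 - x1) by rewrite my; ring.
  rewrite -subr_eq0; apply/eqP.
  have aE : a = m * (y1 + y2) - (x1 ^+ 2 + x1 * x2 + x2 ^+ 2).
    by rewrite -[LHS]addr0 -dm; ring.
  have bE : b = y1 ^+ 2 - x1 ^+ 3 - a * x1 by rewrite h1; ring.
  by rewrite bE aE y2E; ring.
case: eqVneq => [//|ny] /=.
have yy : y1 = y2.
  have /eqP : (y1 - y2) * (y1 + y2) = 0.
    by rewrite -subr_sqr h1 h2 e subrr.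
  by rewrite mulf_eq0 subr_eq0 addr_eq0 (negPf ny) orbF => /eqP.
have y0 : 2 * y1 != 0.
  rewrite mulf_neq0 ?two_neq0 //; apply/eqP => y0.
  by move: ny; rewrite -yy y0 oppr0 eqxx.
set m := _ / _.
have my : m * (2 * y1) = 3 * x1 ^+ 2 + a by rewrite /m mulfVK.
have aE : a = m * (2 * y1) - 3 * x1 ^+ 2 by rewrite my; ring.
have bE : b = y1 ^+ 2 - x1 ^+ 3 - a * x1 by rewrite h1; ring.
rewrite -subr_eq0; apply/eqP; rewrite -e bE aE; ring.
Qed.

Definition pzero : point := exist on_curve None isT.

Definition popp (P : point) : point :=
  exist on_curve (raw_opp (val P)) (on_curve_opp (valP P)).

Definition padd (P Q : point) : point :=
  exist on_curve (raw_add (val P) (val Q)) (on_curve_add (valP P) (valP Q)).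

Definition pmuln (P : point) (n : nat) : point := iter n (padd P) pzero.

Definition pmulz (P : point) (n : int) : point :=
  match n with
  | Posz m => pmuln P m
  | Negz m => popp (pmuln P m.+1)
  end.

Definition torsion (P : point) : Prop :=
  exists2 n : nat, (0 < n)%N & pmuln P n = pzero.

Definition torsion_trivial : Prop := forall P, torsion P <-> P = pzero.

Definition torsion_iso_Z3 : Prop :=
  exists f : 'Z_3 -> point,
    [/\ {morph f : i j / i + j >-> padd i j},
        injective f &
        forall P, torsion P <-> exists i, P = f i].

Definition torsion_generated_by (T : point) : Prop :=
  forall P, torsion P <-> exists n : int, P = pmulz T n.

End Points.

Section CurveEK.

Variable k : fieldType.

Definition p_poly : {poly k} := 1 - 13 * 'X + 26 * 'X^2.
Definition q_poly : {poly k} := 6 + 182 * 'X^2.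
Definition K_poly : {poly k} := p_poly ^+ 3 + q_poly ^+ 3.

(* K(u) as an element of k(u) *)
Definition K_frac : {fraction {poly k}} := tofrac K_poly.

Hypothesis char0 : [pchar k] =i pred0.

Lemma natr_poly_neq0 n : (0 < n)%N -> (n%:R : {fraction {poly k}}) != 0.
Proof.
move=> n_gt0; rewrite -(rmorph_nat (@tofrac {poly k})) tofrac_eq0.
by rewrite -polyC_natr polyC_eq0 ((pcharf0P k).1 char0) -lt0n.
Qed.

Lemma K_poly_neq0 : K_poly != 0.
Proof.
apply/eqP => /(congr1 (fun r : {poly k} => r.[0])).
rewrite horner0 /K_poly /p_poly /q_poly -!(polyC_natr k) !hornerE /= ?mulr0 ?addr0 ?subr0.
have -> : (1 : k) ^+ 3 + 6 ^+ 3 = 217%:R by ring.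
by move/eqP; rewrite ((pcharf0P k).1 char0).
Qed.

Lemma EK_discriminant_neq0 :
  - 16 * (4 * 0 ^+ 3 + 27 * (- (432 * K_frac ^+ 2)) ^+ 2) != 0.
Proof.
have -> : - 16 * (4 * 0 ^+ 3 + 27 * (- (432 * K_frac ^+ 2)) ^+ 2)
          = - ((16 * 27 * 432 ^ 2)%:R * K_frac ^+ 4) by ring.
by rewrite oppr_eq0 mulf_neq0 ?natr_poly_neq0 ?expf_neq0 ?tofrac_eq0 ?K_poly_neq0.
Qed.

Definition EK : ellipticCurve {fraction {poly k}} :=
  EllipticCurve EK_discriminant_neq0.

End CurveEK.

Lemma pchar0_num (R : numFieldType) : [pchar R] =i pred0.
Proof. exact: pchar_num. Qed.

Lemma pchar0_fieldExt (L : fieldExtType rat) : [pchar L] =i pred0.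
Proof. by move=> n; rewrite pchar_lalg pchar_num. Qed.

(* Main.v *)
Require Import Defs.
From mathcomp Require Import all_boot all_order all_algebra all_field.
From mathcomp Require Import ring.

(** The curve [y^2 = x^3 - 432 K^2] is a sextic twist of a curve with constant
coefficients: over an extension of [k(u)] where [b = - 432 K^2] has a sixth
root [w], the point [(x / w^2, y / w^3)] lies on [Y^2 = X^3 + 1], and torsion
points of a constant curve are constant.  So at a torsion point [x^3 / b] is
constant, and the shape of [K] then leaves only [x = 0].

The constancy is obtained from the invariant differential.  Pulling [dX / Y]
back along a point [P] and contracting with [d/du] gives, up to a factor
depending only on [b], the element
  [lambda(P) = (x' - 2 h x) / y], with [h = b' / (6 b)].
The differential being invariant, [lambda] is additive ([log_deriv_add]).
Additivity is checked on the chord-and-tangent formulas, one addition at a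
time, so associativity of the group law never enters: if [n P = 0] then
[n lambda(P) = 0], hence [lambda(P) = 0] in characteristic zero, and this says
that [x^3 / b] has derivative zero ([log_deriv_eq0]).  In [k(u)] such an
element is a constant ([frac_deriv_eq0_const]).

Now [x^3 = c K^2] with [c] in [k].  If [c] were nonzero, [x] would be a
polynomial ([frac_root_poly]).  But [K = (p + q) (p^2 - p q + q^2)], where the
quadratic [p + q] is squarefree and coprime to the other factor; the order of
[K^2] at a root of [p + q] is 2, not a multiple of 3
([simple_factor_cube_square]).  Hence [x = 0] and [(y / (12 K))^2 = - 3], which
has a solution in [k(u)] exactly when it has one in [k].  Conversely, the
points with [x = 0] are inflection points, so doubling one of them gives its
opposite, and together with the point at infinity they form [Z/3Z]. *)

Set Implicit Arguments.
Unset Strict Implicit.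
Unset Printing Implicit Defensive.

Import GRing.Theory.
Local Open Scope ring_scope.

(** * Logarithmic derivatives of points on [y^2 = x^3 + b] *)

Section LogDerivative.

Variables (F : fieldType) (d : F -> F).
Hypothesis dD : {morph d : x y / x + y}.
Hypothesis dM : forall x y, d (x * y) = d x * y + x * d y.

Lemma derivation0 : d 0 = 0.
Proof. by apply: (addrI (d 0)); rewrite -dD !addr0. Qed.

Lemma derivationN x : d (- x) = - d x.
Proof. by apply/eqP; rewrite -subr_eq0 opprK -dD addNr derivation0. Qed.

Lemma derivationB x y : d (x - y) = d x - d y.
Proof. by rewrite dD derivationN. Qed.

Lemma derivation_expn x n : d (x ^+ n.+1) = n.+1%:R * x ^+ n * d x.
Proof.
elim: n => [|n IHn]; first by rewrite expr1 expr0 !mul1r.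
by rewrite exprS dM IHn [in RHS]mulrSr exprS; ring.
Qed.

Variable E : ellipticCurve F.
Hypothesis a0 : coefA E = 0.
Local Notation b := (Defs.coefB E).

Let two0 : (2 : F) != 0 := two_neq0 E.

Let disc : 27 * b ^+ 2 != 0.
Proof.
have := discriminant_neq0 E; rewrite a0 expr0n mulr0 add0r mulf_eq0.
by case/norP.
Qed.

Lemma coefB_neq0 : b != 0.
Proof. by apply: contraNneq disc => ->; rewrite expr0n mulr0. Qed.

Lemma three_neq0 : (3 : F) != 0.
Proof.
apply: contraNneq disc => h; have -> : (27 : F) = 3 * 9 by ring.
by rewrite h !mul0r.
Qed.

(** The logarithmic derivative of a sixth root of [b].  Subtracting [w h z] from
[d z] gives a derivation on elements of weight [w] that kills [b]; the
coordinates [x] and [y] have weights 2 and 3, the slope of a chord weight 1. *)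
Definition twist : F := d b / (6 * b).
Local Notation h := twist.

Lemma twistE : d b = 6 * h * b.
Proof.
have n6 : (6 : F) != 0.
  have -> : (6 : F) = 2 * 3 by ring.
  exact: mulf_neq0 two0 three_neq0.
by rewrite /h; field; rewrite coefB_neq0 n6.
Qed.

(** The two equations express [l = dX / Y = 2 dY / (3 X^2)], and each determines
[l] when its coefficient is nonzero.  Keeping both avoids dividing by [y], so
that points of order two need no separate treatment. *)
Definition is_log_deriv (P : option (F * F)) (l : F) : Prop :=
  if P is Some (x, y) then
    d x - 2 * h * x = l * y /\ 2 * (d y - 3 * h * y) = 3 * l * x ^+ 2
  else l = 0.

(** Differentiating the equation of the curve makes the two equations
proportional, with factors [y] and [3 x^2].  When [y = 0], [x] is nonzero and
both left-hand sides vanish. *)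
Lemma log_deriv_exists P : on_curve E P -> exists l, is_log_deriv P l.
Proof.
case: P => [[x y]|] /=; last by exists 0.
rewrite a0 mul0r addr0 => /eqP Exy.
have key : y * (2 * (d y - 3 * h * y)) = 3 * x ^+ 2 * (d x - 2 * h * x).
  have := congr1 d Exy; rewrite dD !derivation_expn twistE => H.
  transitivity (2 * y ^+ 1 * d y - 6 * h * y ^+ 2); first by ring.
  by rewrite H Exy; ring.
have [y0|y0] := eqVneq y 0; last first.
  exists ((d x - 2 * h * x) / y); split; first by rewrite divfK.
  by apply: (mulfI y0); rewrite key; field.
exists 0; rewrite y0 derivation0 !(mulr0, subr0, mul0r); split=> //.
move/esym/eqP: key; rewrite y0 mul0r mulf_eq0 => /orP[|/eqP //].
rewrite mulf_eq0 (negPf three_neq0) expf_eq0 /= => /eqP x0.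
by move: Exy coefB_neq0; rewrite y0 x0 !expr0n add0r => <-; rewrite eqxx.
Qed.

(** The common core of chords and tangents.  On the line of slope [m] through
the two points, the two hypotheses on [m] are what remains of the curve
equations after division, and they make the third point symmetric in the
first two.  The hypothesis on [d m] says how the line moves with its points;
everything else is linear in [l1] and [l2]. *)
Lemma log_deriv_line x1 y1 x2 y2 m l1 l2 :
  is_log_deriv (Some (x1, y1)) l1 -> is_log_deriv (Some (x2, y2)) l2 ->
  m * (x2 - x1) = y2 - y1 ->
  m * (y1 + y2) = x1 ^+ 2 + x1 * x2 + x2 ^+ 2 ->
  let x3 := m ^+ 2 - x1 - x2 in
  2 * (d m - h * m) = l1 * (x1 - x3) + l2 * (x2 - x3) ->
  is_log_deriv (Some (x3, m * (x1 - x3) - y1)) (l1 + l2).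
Proof.
move=> /= [e1 f1] [e2 f2] T S; set x3 := m ^+ 2 - x1 - x2; set y3 := _ - y1 => M.
have dx3 : d x3 - 2 * h * x3 = (l1 + l2) * y3.
  rewrite /x3 !derivationB derivation_expn expr1.
  transitivity (m * (2 * (d m - h * m)) - (d x1 - 2 * h * x1) - (d x2 - 2 * h * x2)).
    by ring.
  rewrite M e1 e2.
  transitivity ((l1 + l2) * y3 + l2 * (m * (x2 - x1) - (y2 - y1))).
    by rewrite /y3; ring.
  by rewrite T; ring.
split=> //.
transitivity (2 * (d m - h * m) * (x1 - x3)
   + 2 * m * ((d x1 - 2 * h * x1) - (d x3 - 2 * h * x3))
   - 2 * (d y1 - 3 * h * y1)).
  by rewrite /y3 !derivationB dM !derivationB; ring.
rewrite M dx3 e1 f1.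
(* Eliminating y2 leaves y1 only through m * y1. *)
have Q : 2 * m * y1 = x1 ^+ 2 + x1 * x2 + x2 ^+ 2 - m ^+ 2 * (x2 - x1).
  transitivity (m * (y1 + y2) - m * (y2 - y1)); first by ring.
  by rewrite S -T; ring.
have -> : 2 * m * (l1 * y1 - (l1 + l2) * y3)
   = (2 * l1 + l2) * (2 * m * y1) - 2 * (l1 + l2) * m ^+ 2 * (x1 - x3).
  by rewrite /y3; ring.
by rewrite Q /x3; ring.
Qed.

(** Invariance of the differential under translation, the chord and tangent
cases differing only in how the derivative of the slope is computed. *)
Lemma log_deriv_add P Q l1 l2 :
  on_curve E P -> on_curve E Q -> is_log_deriv P l1 -> is_log_deriv Q l2 ->
  is_log_deriv (raw_add E P Q) (l1 + l2).
Proof.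
case: P Q => [[x1 y1]|] [[x2 y2]|] //=; last 3 first.
- by move=> _ _ h1 ->; rewrite addr0.
- by move=> _ _ -> h2; rewrite add0r.
- by move=> _ _ -> ->; rewrite addr0.
rewrite a0 !mul0r !addr0 => /eqP E1 /eqP E2 L1 L2.
have [e1 f1] := L1; have [e2 f2] := L2.
have [ex|nx] /= := eqVneq x1 x2; last first.
  have dx : x2 - x1 != 0 by rewrite subr_eq0 eq_sym.
  set m := _ / _.
  have T : m * (x2 - x1) = y2 - y1 by rewrite /m divfK.
  have S : m * (y1 + y2) = x1 ^+ 2 + x1 * x2 + x2 ^+ 2.
    apply: (mulIf dx); transitivity (m * (x2 - x1) * (y1 + y2)); first by ring.
    rewrite T; transitivity (y2 ^+ 2 - y1 ^+ 2); first by ring.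
    by rewrite E1 E2; ring.
  apply: (log_deriv_line L1 L2 T S).
  have := congr1 d T; rewrite dM !derivationB => dT.
  apply: (mulIf dx).
  transitivity (2 * (d y2 - 3 * h * y2) - 2 * (d y1 - 3 * h * y1)
     - 2 * m * ((d x2 - 2 * h * x2) - (d x1 - 2 * h * x1))
     + 2 * (d m * (x2 - x1) + m * (d x2 - d x1) - (d y2 - d y1))
     - 6 * h * (m * (x2 - x1) - (y2 - y1))); first by ring.
  rewrite dT T !subrr !mulr0 subr0 addr0 e1 e2 f1 f2.
  apply/eqP; rewrite -subr_eq0; apply/eqP.
  transitivity ((l1 - l2) * (m * (y1 + y2) - (x1 ^+ 2 + x1 * x2 + x2 ^+ 2))
     + (l1 + l2) * m * (m * (x2 - x1) - (y2 - y1))); first by ring.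
  by rewrite T S !subrr !mulr0 addr0.
move: x2 ex E2 L2 e2 f2 => _ <- E2 L2 e2 f2.
(* For opposite points one of the two defining equations forces l1 + l2 = 0:
   the second when y1 = 0, the first otherwise. *)
have [ey|ny] /= := eqVneq y1 (- y2).
  have y2E : y2 = - y1 by rewrite ey opprK.
  move: e2 f2; rewrite y2E derivationN => e2 f2.
  have [y0|y0] := eqVneq y1 0.
    have x0 : 3 * x1 ^+ 2 != 0.
      rewrite mulf_neq0 ?three_neq0 // expf_eq0 /=.
      apply: contraNneq coefB_neq0 => x0.
      by move: E1; rewrite y0 x0 !expr0n add0r => <-.
    apply: (mulIf x0); rewrite mul0r.
    transitivity (3 * l1 * x1 ^+ 2 + 3 * l2 * x1 ^+ 2); first by ring.
    by rewrite -f1 -f2; ring.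
  apply: (mulIf y0); rewrite mul0r.
  transitivity (l1 * y1 - l2 * - y1); first by ring.
  by rewrite -e1 -e2; ring.
have yy : y1 = y2.
  have /eqP : (y1 - y2) * (y1 + y2) = 0 by rewrite -subr_sqr E1 E2 subrr.
  by rewrite mulf_eq0 subr_eq0 addr_eq0 (negPf ny) orbF => /eqP.
move: y2 yy ny E2 L2 e2 f2 => _ <- ny E2 L2 e2 f2.
have y0 : y1 != 0 by apply: contraNneq ny => ->; rewrite oppr0.
have yy0 : 2 * y1 != 0 by rewrite mulf_neq0.
have l12 : l2 = l1 by apply: (mulIf y0); rewrite -e1 -e2.
set m := _ / _.
have my : m * (2 * y1) = 3 * x1 ^+ 2 by rewrite /m divfK.
apply: (log_deriv_line L1 L2); first by rewrite !subrr mulr0.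
  by transitivity (m * (2 * y1)); [ring | rewrite my; ring].
have d2 x : d (2 * x) = 2 * d x.
  have dbl (z : F) : 2 * z = z + z by ring.
  by rewrite !dbl dD.
have := congr1 d my; have -> : 3 * x1 ^+ 2 = x1 ^+ 2 + 2 * x1 ^+ 2 by ring.
rewrite dD d2 derivation_expn expr1 dM d2 => dm.
rewrite l12; apply: (mulIf yy0).
transitivity (2 * (d m * (2 * y1) + m * (2 * d y1)) - 2 * (m * (2 * (d y1 - 3 * h * y1)))
   - 8 * h * (m * (2 * y1))); first by ring.
rewrite dm my f1.
transitivity (12 * x1 * (d x1 - 2 * h * x1) - 6 * m * l1 * x1 ^+ 2); first by ring.
rewrite e1.
transitivity (12 * x1 * (l1 * y1) - 2 * m * l1 * (3 * x1 ^+ 2)); first by ring.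
by rewrite -my; ring.
Qed.

Lemma log_deriv_muln (P : point E) l n :
  is_log_deriv (val P) l -> is_log_deriv (val (pmuln P n)) (n%:R * l).
Proof.
move=> Pl; elim: n => [|n IHn]; first by rewrite mul0r.
have -> : n.+1%:R * l = l + n%:R * l by rewrite mulrS mulrDl mul1r.
by apply: log_deriv_add; rewrite ?(valP P) ?(valP (pmuln P n)).
Qed.

(** [x^3 / b] has weight zero, so its derivative is [3 x^2 / b] times the weighted
derivative of [x], and the latter vanishes with the logarithmic derivative. *)
Lemma log_deriv_eq0 x y :
  is_log_deriv (Some (x, y)) 0 -> d (x ^+ 3 / b) = 0.
Proof.
move=> [/eqP dx _]; apply: (mulIf coefB_neq0); rewrite mul0r.
have := dM (x ^+ 3 / b) b; rewrite divfK ?coefB_neq0 // => /(canLR (addrK _)) <-.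
move: dx; rewrite mul0r subr_eq0 derivation_expn twistE => /eqP ->.
transitivity (6 * h * x ^+ 3 - 6 * h * (x ^+ 3 / b * b)); first by ring.
by rewrite divfK ?coefB_neq0 // subrr.
Qed.

End LogDerivative.

(** * The derivation d/du on rational functions *)

(** The primed letters are independent variables standing for derivatives, so
that the sum and product rules become field identities. *)
Section QuotientRule.

Variables (K : fieldType) (a b c e a' b' c' e' : K).
Hypotheses (b0 : b != 0) (e0 : e != 0).

Lemma quotient_ruleD :
  ((a' * e + a * e' + (c' * b + c * b')) * (b * e)
     - (a * e + c * b) * (b' * e + b * e')) / (b * e) ^+ 2
  = (a' * b - a * b') / b ^+ 2 + (c' * e - c * e') / e ^+ 2.
Proof. by field; rewrite b0 e0. Qed.

Lemma quotient_ruleM :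
  ((a' * c + a * c') * (b * e) - a * c * (b' * e + b * e')) / (b * e) ^+ 2
  = (a' * b - a * b') / b ^+ 2 * (c / e)
    + a / b * ((c' * e - c * e') / e ^+ 2).
Proof. by field; rewrite b0 e0. Qed.

End QuotientRule.

Section RationalFunctions.

Variable k : fieldType.
Local Notation kX := {poly k}.
Local Notation kU := {fraction {poly k}}.
Local Notation "p %:F" := (@tofrac {poly k} p) (at level 1, format "p %:F").
Implicit Types (p q r m a b e : kX) (x y : kU).

Lemma frac_repr x : x = (\n_(repr x))%:F / (\d_(repr x))%:F.
Proof.
set r := repr x; have d0 : (\d_r)%:F != 0 by rewrite tofrac_eq0 denom_ratioP.
apply: (mulIf d0); rewrite divfK // -[x in LHS]reprK -/r.
rewrite -[_ * _]/(FracField.mul _ _) !piE; apply/eqmodP.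
rewrite /= FracField.equivfE /FracField.mulf.
rewrite !numden_Ratio ?mulf_neq0 ?oner_eq0 ?denom_ratioP //.
by apply/eqP; ring.
Qed.

Lemma frac_eqE p q a b : a != 0 -> b != 0 ->
  (p%:F / a%:F == q%:F / b%:F) = (p * b == q * a).
Proof.
move=> a0 b0; have [aF bF] : a%:F != 0 /\ b%:F != 0 by rewrite !tofrac_eq0.
by rewrite (eqr_div _ _ aF bF) -2!tofracM tofrac_eq.
Qed.

Lemma frac_coprime x :
  exists a b, [/\ b != 0, coprimep a b & x = a%:F / b%:F].
Proof.
have := frac_repr x; move: (denom_ratioP (repr x)).
move: (\n_(repr x)) (\d_(repr x)) => n m m0 ->.
have g0 : gcdp n m != 0 by rewrite gcdp_eq0 negb_and m0 orbT.
exists (n %/ gcdp n m), (m %/ gcdp n m); split.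
- by rewrite divp_eq0 !negb_or m0 g0 -leqNgt leq_gcdpr.
- by rewrite coprimep_div_gcd // m0 orbT.
set g := gcdp n m; transitivity ((n %/ g * g)%:F / (m %/ g * g)%:F).
  by rewrite !divpK ?dvdp_gcdl ?dvdp_gcdr.
rewrite !tofracM /=.
by rewrite -mulf_div divff ?mulr1 ?tofrac_eq0.
Qed.

(** Polynomial rings are integrally closed: the denominator of a fraction in
lowest terms divides its numerator as soon as its power does. *)
Lemma frac_root_poly x n p : x ^+ n.+1 = p%:F -> exists e, x = e%:F.
Proof.
have [a [b [b0 cab ->]]] := frac_coprime x.
have bF0 : b%:F != 0 by rewrite tofrac_eq0.
rewrite expr_div_n => /(canRL (divfK _)); rewrite expf_neq0 // => /(_ isT) /eqP.
rewrite -2!tofracXn -tofracM tofrac_eq => /eqP ab.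
have dba : b %| a by rewrite -(@dvdp_pexp2r _ b a n.+1) // ab dvdp_mull.
by exists (a %/ b); rewrite -{1}(divpK dba) tofracM mulfK.
Qed.

(** The quotient rule on the chosen representative of [x]; [frac_derivE] shows that
every representative gives the same value. *)
Definition frac_deriv x : kU :=
  let n := \n_(repr x) in let m := \d_(repr x) in
  (n^`() * m - n * m^`())%:F / (m ^+ 2)%:F.

Lemma frac_derivE a b : b != 0 ->
  frac_deriv (a%:F / b%:F) = (a^`()%:F * b%:F - a%:F * b^`()%:F) / b%:F ^+ 2.
Proof.
rewrite -2!tofracM -tofracB -(tofracXn 2).
move=> b0; have := frac_repr (a%:F / b%:F); rewrite /frac_deriv.
move: (denom_ratioP (repr (a%:F / b%:F))).
move: (\n_(repr (a%:F / b%:F))) (\d_(repr (a%:F / b%:F))) => n m m0.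
move/eqP; rewrite (frac_eqE _ _ b0 m0) => /eqP amnb.
apply/eqP; rewrite frac_eqE ?expf_neq0 //.
have := congr1 (@deriv k) amnb; rewrite !derivM => dE.
apply/eqP.
transitivity ((n^`() * b) * m * b - (n * b) * m^`() * b); first by ring.
have -> : n^`() * b = a^`() * m + a * m^`() - n * b^`() by rewrite dE; ring.
transitivity ((a^`() * m + a * m^`()) * m * b - (n * b) * b^`() * m - (n * b) * m^`() * b).
  by ring.
by rewrite -amnb; ring.
Qed.

Lemma frac_derivD : {morph frac_deriv : x y / x + y}.
Proof.
move=> x y; have [a [b [b0 _ ->]]] := frac_coprime x.
have [c [e [e0 _ ->]]] := frac_coprime y.
have [bF eF] : b%:F != 0 /\ e%:F != 0 by rewrite !tofrac_eq0.
rewrite (addf_div _ _ bF eF) -3!tofracM -tofracD !frac_derivE ?mulf_neq0 //.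
rewrite derivD !derivM 5!tofracD !tofracM.
by rewrite (quotient_ruleD _ _ _ _ _ _ bF eF).
Qed.

Lemma frac_derivM x y :
  frac_deriv (x * y) = frac_deriv x * y + x * frac_deriv y.
Proof.
have [a [b [b0 _ ->]]] := frac_coprime x.
have [c [e [e0 _ ->]]] := frac_coprime y.
have [bF eF] : b%:F != 0 /\ e%:F != 0 by rewrite !tofrac_eq0.
rewrite mulf_div -2!tofracM !frac_derivE ?mulf_neq0 //.
rewrite !derivM 2!tofracD !tofracM.
by rewrite (quotient_ruleM _ _ _ _ _ _ bF eF).
Qed.

(** * Constants and cubes in characteristic zero *)

Hypothesis char0 : [pchar k] =i pred0.

Lemma natr_neq0 n : (0 < n)%N -> (n%:R : k) != 0.
Proof. by rewrite ((pcharf0P k).1 char0) lt0n. Qed.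

Lemma deriv_eq0_const p : p^`() = 0 -> exists c, p = c%:P.
Proof.
move=> p'0; exists p`_0; apply/polyP => -[|i]; rewrite coefC //=.
have /eqP := congr1 (fun q : kX => q`_i) p'0.
by rewrite coef_deriv coef0 -mulr_natr mulf_eq0 orbC (negPf (natr_neq0 _)) // => /eqP.
Qed.

(** The derivative has smaller size, so it can be a multiple only by vanishing. *)
Lemma dvdp_deriv_const p : p %| p^`() -> exists c, p = c%:P.
Proof.
move=> dpp; apply: deriv_eq0_const; apply/eqP; apply: contraTT dpp => p'0.
have p0 : p != 0 by apply: contraNneq p'0 => ->; rewrite deriv0.
by rewrite gtNdvdp // lt_size_deriv.
Qed.

(** If [a / b] is in lowest terms and [a' b = a b'], then [a] divides [a'] and [b]
divides [b'], so both are constants. *)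
Lemma frac_deriv_eq0_const x : frac_deriv x = 0 -> exists c : k, x = (c%:P)%:F.
Proof.
have [a [b [b0 cab ->]]] := frac_coprime x.
rewrite frac_derivE // => /eqP; rewrite mulf_eq0 invr_eq0 expf_eq0 /=.
rewrite [b%:F == 0]tofrac_eq0 (negPf b0) orbF subr_eq0 -2!tofracM tofrac_eq => /eqP ab.
have [u uE] : exists u, a = u%:P.
  apply: dvdp_deriv_const; rewrite -(@Gauss_dvdpl _ _ b) // ab.
  exact: dvdp_mulr.
have [v vE] : exists v, b = v%:P.
  apply: dvdp_deriv_const; rewrite -(@Gauss_dvdpr _ _ a) 1?coprimep_sym // -ab.
  exact: dvdp_mull.
have v0 : v != 0 by rewrite -polyC_eq0 -vE.
exists (u / v); apply: (mulIf (_ : b%:F != 0)); rewrite ?tofrac_eq0 //.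
by rewrite divfK ?tofrac_eq0 // -tofracM uE vE -polyCM divfK.
Qed.

Lemma coprimep_natr p q u v n : (0 < n)%N -> u * p + v * q = n%:R -> coprimep p q.
Proof.
move=> n0 uv; apply/Bezout_coprimepP; exists (u, v); rewrite /= uv -polyC_natr.
by rewrite polyC_eqp1 natr_neq0.
Qed.

(** The order of [e^3] at a root of [r] is a multiple of 3, that of [(r m)^2] is
2.  Since [r] need not be irreducible, the argument runs on [r] as a whole:
differentiating shows that [r] divides [e], hence [r^3] divides [r^2 m^2]. *)
Lemma simple_factor_cube_square r m e (c : k) :
  (1 < size r)%N -> coprimep r r^`() -> coprimep r m -> c != 0 ->
  e ^+ 3 = c *: (r * m) ^+ 2 -> False.
Proof.
move=> r1 cr' crm c0 eE.
have two : (2 : kX) = 2%:R%:P by rewrite polyC_natr.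
have rm0 : (r * m) != 0.
  rewrite mulf_neq0 //; first by rewrite -size_poly_gt0 (ltn_trans _ r1).
  by apply: contraTneq crm => ->; rewrite coprimep0 -size_poly_eq1 neq_ltn r1 orbT.
(* Logarithmic derivative of the hypothesis, cleared of denominators. *)
have de : 3 * e^`() * (r * m) = 2 * (r * m)^`() * e.
  have := congr1 (@deriv k) eE; rewrite derivZ !deriv_exp /= => dE.
  apply: (mulfI rm0); apply: (@mulfI _ c%:P); first by rewrite polyC_eq0.
  transitivity (e^`() * 3 * (c *: (r * m) ^+ 2)); first by rewrite -mul_polyC; ring.
  rewrite -eE; transitivity (e * (e^`() * e ^+ 2 *+ 3)); first by ring.
  by rewrite dE -mul_polyC; ring.
have re : r %| e.
  rewrite -(@Gauss_dvdpr _ _ (r^`() * m)) ?coprimepMr ?cr' //.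
  rewrite -(@dvdpZr _ 2%:R) ?natr_neq0 // -mul_polyC -two.
  suff -> : 2 * (r^`() * m * e) = r * (3 * e^`() * m - 2 * m^`() * e).
    exact: dvdp_mulr.
  transitivity (2 * (r * m)^`() * e - 2 * r * m^`() * e); first by rewrite derivM; ring.
  by rewrite -de; ring.
have r0 : r != 0 by rewrite -size_poly_gt0 (ltn_trans _ r1).
have rm2 : r %| m ^+ 2.
  rewrite -(dvdpZr _ _ c0).
  suff -> : c *: m ^+ 2 = (e %/ r) ^+ 3 * r by apply: dvdp_mull.
  apply: (mulfI (expf_neq0 2 r0)); transitivity (((e %/ r) * r) ^+ 3); last by ring.
  by rewrite divpK // eE -!mul_polyC; ring.
have /coprimepP /(_ r (dvdpp r) rm2) := coprimep_expr 2 crm.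
by rewrite -size_poly_eq1 gtn_eqF.
Qed.

End RationalFunctions.

(** * The factor p + q of K *)

Section TorsionPoints.

Variables (k : fieldType) (char0 : [pchar k] =i pred0).
Local Notation kX := {poly k}.
Local Notation kU := {fraction {poly k}}.
Local Notation "p %:F" := (@tofrac {poly k} p) (at level 1, format "p %:F").
Local Notation E := (EK char0).
Local Notation K := (K_poly k).
Local Notation b := (Defs.coefB E).

Definition sum_factor : kX := p_poly k + q_poly k.
Definition sum_cofactor : kX :=
  p_poly k ^+ 2 - p_poly k * q_poly k + q_poly k ^+ 2.
Local Notation r := sum_factor.
Local Notation m := sum_cofactor.

Lemma K_factor : K = r * m.
Proof. by rewrite /K_poly /r /m; ring. Qed.

Lemma sum_factorE : r = 7 - 13 * 'X + 208 * 'X^2.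
Proof. by rewrite /r /p_poly /q_poly; ring. Qed.

Lemma deriv_sum_factor : r^`() = 416 * 'X - 13.
Proof.
rewrite sum_factorE -!(polyC_natr k).
rewrite derivD derivB !mul_polyC !derivZ derivXn derivX derivC /= -!mul_polyC !(polyC_natr k).
by ring.
Qed.

Lemma size_sum_factor : (1 < size r)%N.
Proof.
rewrite ltnNge; apply/negP => /size1_polyC rE.
have := deriv_sum_factor; rewrite rE derivC => /(congr1 (fun p : kX => p`_1)).
rewrite coef0 -!(polyC_natr k) coefB coefCM coefX coefC /= mulr1 subr0 => /esym/eqP.
by rewrite (negPf (natr_neq0 char0 _)).
Qed.

(** Completing the square: [4 * 208 * r = r'^2 + 5655], and [- 5655] is the
discriminant of [r]. *)
Lemma sum_factor_squarefree : coprimep r r^`().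
Proof.
apply: (@coprimep_natr k char0 _ _ 832 (- r^`()) 5655) => //.
by rewrite deriv_sum_factor sum_factorE; ring.
Qed.

(** Modulo [r = p + q] the cofactor is [3 q^2], so it is enough that [q] is coprime
to [r]; two steps of the Euclidean algorithm reach the constant 548. *)
Lemma coprime_factors : coprimep r m.
Proof.
have rq : coprimep r (q_poly k).
  apply: (@coprimep_natr k char0 _ _ (7 * (182 * 'X + 2)) (91 - 8 * (182 * 'X + 2)) 548) => //.
  by rewrite sum_factorE /q_poly; ring.
have -> : m = (r - 3 * q_poly k) * r + 3%:R%:P * q_poly k ^+ 2.
  by rewrite /m /r polyC_natr; ring.
rewrite coprimep_addl_mul coprimepMr coprimep_expr // andbT.
by apply: (@coprimep_natr k char0 _ _ 0 1 3) => //; rewrite polyC_natr; ring.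
Qed.

(** * Torsion points have x = 0 *)

Lemma K_frac_neq0 : K_frac k != 0.
Proof. by rewrite tofrac_eq0 K_poly_neq0. Qed.

Lemma kU_natr_neq0 n : (0 < n)%N -> (n%:R : kU) != 0.
Proof. exact: natr_poly_neq0. Qed.

(** The point [n P] at infinity has logarithmic derivative [n l], which is zero
only for [l = 0]. *)
Lemma torsion_log_deriv (P : point E) :
  torsion P -> is_log_deriv (@frac_deriv k) E (val P) 0.
Proof.
case=> n n0 nP; have a0 : coefA E = 0 by [].
have [l Pl] := log_deriv_exists (@frac_derivD k) (@frac_derivM k) a0 (valP P).
have := log_deriv_muln (@frac_derivD k) (@frac_derivM k) a0 n Pl.
by rewrite nP /= => /eqP; rewrite mulf_eq0 (negPf (kU_natr_neq0 n0)) => /eqP <-.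
Qed.

Lemma torsion_x_eq0 (P : point E) x y :
  torsion P -> val P = Some (x, y) -> x = 0.
Proof.
move=> /torsion_log_deriv Pl PE; move: Pl; rewrite PE => Pl.
have a0 : coefA E = 0 by [].
have b0 : b != 0 := coefB_neq0 a0.
have [c cE] : exists c : k, x ^+ 3 / b = (c%:P)%:F.
  apply: (frac_deriv_eq0_const char0).
  exact: (log_deriv_eq0 (@frac_derivM k) a0 Pl).
have x3 : x ^+ 3 = (((- 432%:R) * c) *: K ^+ 2)%:F.
  rewrite -[LHS](divfK b0) cE /= -mul_polyC polyCM polyCN polyC_natr.
  by rewrite 2!tofracM tofracXn tofracN rmorph_nat -/(K_frac k); ring.
have [c0|c0] := eqVneq c 0.
  by move/eqP: x3; rewrite c0 mulr0 scale0r tofrac0 expf_eq0 => /andP[_ /eqP].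
have [e eE] := frac_root_poly x3.
have /eqP := x3; rewrite eE -tofracXn tofrac_eq K_factor => /eqP e3.
exfalso; apply: (simple_factor_cube_square char0 size_sum_factor
  sum_factor_squarefree coprime_factors _ e3).
by rewrite mulf_neq0 // oppr_eq0 natr_neq0.
Qed.

(** The square root of [- 3] found in [k(u)] is a polynomial, of degree zero
because its square is constant. *)
Lemma torsion_sqrt (P : point E) x y :
  torsion P -> val P = Some (x, y) ->
  exists s : k, s ^+ 2 = - 3 /\ y = 12 * (s%:P)%:F * K_frac k.
Proof.
move=> tP PE; have x0 := torsion_x_eq0 tP PE.
have := valP P; rewrite PE /= x0 mul0r addr0 expr0n add0r => /eqP y2.
have K0 := K_frac_neq0.
have K12 : 12 * K_frac k != 0 by rewrite mulf_neq0 ?kU_natr_neq0.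
have w2 : (y / (12 * K_frac k)) ^+ 2 = (- 3%:R)%:F.
  rewrite tofracN rmorph_nat expr_div_n y2.
  apply: (mulIf (expf_neq0 2 K12)); rewrite divfK ?expf_neq0 //.
  by ring.
have [e eE] := frac_root_poly w2.
have e2 : e ^+ 2 = - 3%:R by move/eqP: w2; rewrite eE -tofracXn tofrac_eq => /eqP.
have /size1_polyC eC : (size e <= 1)%N.
  have := congr1 (fun p : kX => size p) e2.
  rewrite /= size_polyN -polyC_natr size_polyC natr_neq0 // => se.
  have e0 : e != 0 by apply: contra_eqN se => /eqP ->; rewrite expr0n size_poly0.
  by move: se; rewrite expr2 size_mul //; case: (size e) => [|[|n]] //=; rewrite addnS.
exists e`_0; split.
  by apply/polyC_inj; rewrite rmorphXn /= -eC e2 polyCN polyC_natr.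
by rewrite -eC -eE mulrAC mulrC divfK.
Qed.

(** * The subgroup of order three *)

Section InflectionPoints.

Variable s : k.
Hypothesis s2 : s ^+ 2 = - 3.

Definition ordinate : kU := 12 * (s%:P)%:F * K_frac k.

Lemma ordinate_sqr : ordinate ^+ 2 = - (432 * K_frac k ^+ 2).
Proof.
rewrite /ordinate !exprMn -tofracXn -polyC_exp s2 polyCN polyC_natr tofracN rmorph_nat.
by ring.
Qed.

Lemma ordinate_neq0 : ordinate != 0.
Proof.
apply/eqP => y0; have /esym/eqP := ordinate_sqr.
by rewrite y0 expr0n oppr_eq0 mulf_eq0 expf_eq0 (negPf K_frac_neq0) (negPf (kU_natr_neq0 _)).
Qed.

Lemma ordinate_on_curve : on_curve E (Some (0, ordinate)).
Proof. by rewrite /= ordinate_sqr expr0n mul0r addr0 add0r. Qed.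

Definition T3 : point E := exist (on_curve E) _ ordinate_on_curve.

Definition Z3_point (i : 'Z_3) : point E :=
  if i == 0 then pzero E else if i == 1 then T3 else popp T3.

Lemma ordinate_neq_opp : (ordinate == - ordinate) = false.
Proof.
rewrite -addr_eq0 -mulr2n -mulr_natl mulf_eq0.
by rewrite (negPf ordinate_neq0) (negPf (kU_natr_neq0 _)).
Qed.

(** The tangent at a point with [x = 0] is horizontal and meets the curve there
three times. *)
Lemma raw_double_inflection (y : kU) :
  (y == - y) = false -> raw_add E (Some (0, y)) (Some (0, y)) = Some (0, - y).
Proof.
have slope0 : (3 * 0 ^+ 2 + coefA E) / (2 * y) = 0.
  by rewrite expr0n mulr0 addr0 mul0r.
by move=> yn; rewrite /raw_add eqxx yn slope0 expr0n /= !subr0 mul0r sub0r.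
Qed.

Lemma raw_double_inflection_opp (y : kU) :
  (y == - y) = false -> raw_add E (Some (0, - y)) (Some (0, - y)) = Some (0, y).
Proof.
by move=> yn; rewrite raw_double_inflection opprK // eq_sym.
Qed.

Lemma raw_add_opp (x y : kU) : raw_add E (Some (x, y)) (Some (x, - y)) = None.
Proof. by rewrite /raw_add opprK !eqxx. Qed.

Lemma raw_opp_add (x y : kU) : raw_add E (Some (x, - y)) (Some (x, y)) = None.
Proof. by rewrite /raw_add !eqxx. Qed.

Lemma Z3_pointD : {morph Z3_point : i j / i + j >-> padd i j}.
Proof.
move=> i j; apply: val_inj; move: i j.
move=> [[|[|[|i]]] Hi] [[|[|[|j]]] Hj] //.
- exact: esym (raw_double_inflection ordinate_neq_opp).
- exact: esym (raw_add_opp _ _).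
- exact: esym (raw_opp_add _ _).
- exact: esym (raw_double_inflection_opp ordinate_neq_opp).
Qed.

Lemma Z3_point_inj : injective Z3_point.
Proof.
move=> i j /(congr1 val) H; apply: val_inj; move: i j H.
move=> [[|[|[|i]]] Hi] [[|[|[|j]]] Hj] // [] /eqP; last rewrite eq_sym.
  all: by rewrite ordinate_neq_opp.
Qed.

Lemma Z3_point_opp i : popp (Z3_point i) = Z3_point (- i).
Proof.
apply: val_inj; case: i => [[|[|[|i]]] Hi] //=; by rewrite /Z3_point /= ?opprK.
Qed.

Lemma Z3_point_muln i n : pmuln (Z3_point i) n = Z3_point (i *+ n).
Proof. by elim: n => [|n IHn] //=; rewrite IHn mulrS Z3_pointD. Qed.

Lemma torsion_Z3P P : torsion P <-> exists i, P = Z3_point i.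
Proof.
split=> [tP|[i ->]]; last first.
  exists 3%N => //; rewrite Z3_point_muln.
  have -> : i *+ 3 = 0 by rewrite -mulr_natr (_ : 3%:R = 0 :> 'Z_3) ?mulr0 //; apply: val_inj.
  by [].
case PE : (val P) => [[x y]|]; last by exists 0; apply: val_inj.
have x0 := torsion_x_eq0 tP PE.
have := valP P; rewrite PE /= x0 mul0r addr0 expr0n add0r -ordinate_sqr.
rewrite eqf_sqr => /orP[] /eqP yE; [exists 1|exists (- 1)]; apply: val_inj;
  by rewrite /= PE x0 yE.
Qed.

Lemma torsion_iso_Z3_of_sqrt : torsion_iso_Z3 E.
Proof. exists Z3_point; split; [exact: Z3_pointD|exact: Z3_point_inj|exact: torsion_Z3P]. Qed.

Lemma T3_generates_torsion : torsion_generated_by T3.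
Proof.
have mulE n : pmuln T3 n = Z3_point (n%:R) by exact: (Z3_point_muln 1 n).
move=> P; rewrite torsion_Z3P; split=> [[i ->]|[[n|n] ->]].
- by exists (Posz i); rewrite /= mulE natr_Zp.
- by exists n%:R; rewrite /= mulE.
- by exists (- n.+1%:R); rewrite /pmulz mulE Z3_point_opp.
Qed.

End InflectionPoints.

Lemma torsion_trivial_of_no_sqrt :
  (~ exists s : k, s ^+ 2 = - 3) -> torsion_trivial E.
Proof.
move=> nos P; split=> [tP|->]; last by exists 1%N => //; exact: val_inj.
case PE : (val P) => [[x y]|]; last exact: val_inj.
by have [s [s2 _]] := torsion_sqrt tP PE; case: nos; exists s.
Qed.

End TorsionPoints.

Theorem theorem5p5 :
  (forall (k : fieldType) (char0 : [pchar k] =i pred0),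
      ((~ exists s : k, s ^+ 2 = - 3) -> torsion_trivial (EK char0))
      /\
      (forall s : k, s ^+ 2 = - 3 ->
         torsion_iso_Z3 (EK char0) /\
         exists T : point (EK char0),
           val T = Some (0, 12 * tofrac s%:P * K_frac k) /\
           torsion_generated_by T))
  /\ torsion_trivial (EK (pchar0_num rat))
  /\ (forall (L : fieldExtType rat) (z : L),
        z ^+ 2 = - 3 -> <<1%AS; z>>%VS = fullv ->
        torsion_iso_Z3 (EK (pchar0_fieldExt L)))
  /\ torsion_iso_Z3 (EK (pchar0_num algC)).
Proof.
split; [|split; [|split]].
- move=> k char0; split; first exact: torsion_trivial_of_no_sqrt.
  move=> s s2; split; first exact: torsion_iso_Z3_of_sqrt s2.
  by exists (T3 char0 s2); split=> //; exact: T3_generates_torsion.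
- apply: torsion_trivial_of_no_sqrt => -[s s2].
  by have := Num.Theory.sqr_ge0 s; rewrite s2.
- by move=> L z z2 _; exact: torsion_iso_Z3_of_sqrt z2.
- apply: (torsion_iso_Z3_of_sqrt _ (s := Num.Theory.sqrtC (- 3))); exact: Num.Theory.sqrtCK.
Qed.
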